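(* Let $\boldsymbol{k}$ be a field and let $\phi=[0;u_1X+v_1,u_2X+v_2,u_3X+v_3,\ldots]\in\overline{\boldsymbol{k}((X^{-1}))}$ with $u_i\in\boldsymbol{k}\setminus\{0\}$, $v_i\in\boldsymbol{k}$ for all $i\ge1$, and let $\phi=\sum_{i\ge1}c_iX^{-i}$ be its Laurent series expansion. Let $\mathcal{R}_\phi$, $\mathcal{U}_\phi$, $\mathcal{L}_\phi$ and $\mathcal{M}_\phi$ be as defined in the context. Then: 1. $\mathcal{L}_\phi$ is a lower triangular matrix and $\mathcal{U}_\phi$ is an upper triangular matrix, both with all diagonal entries nonzero (non-singular). 2. For every $n\ge1$, the $n$th column of $\mathcal{U}_\phi$ collects the coefficients of the $\phi$-Zeckendorf representation of $X^{n-1}$: if $X^{n-1}=\sum_{i=0}^{n-1}z_iF_i(X)$, then the $n$th column is $(z_0,z_1,\ldots,z_{n-1},0,0,\ldots)^T$. 3. The product $\mathcal{L}_\phi\mathcal{U}_\phi$ is a Hankel matrix, i.e. its $(i,j)$ entry depends only on $i+j$. 4. $u_1^{-1}\mathcal{L}_\phi\mathcal{U}_\phi=\mathcal{M}_\phi$.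
   Context: $\boldsymbol{k}((X^{-1}))$ is the field of formal Laurent series in $X^{-1}$ over $\boldsymbol{k}$, and $\overline{\boldsymbol{k}((X^{-1}))}=\{\sum_{i\ge1}c_iX^{-i}:c_i\in\boldsymbol{k}\}$. The continued fraction $[0;A_1,A_2,\ldots]$ means $\cfrac{1}{A_1+\cfrac{1}{A_2+\cdots}}$. The Fibonacci polynomials associated with $\phi$ are $F_{-1}=0$, $F_0=1$, $F_n(X)=(u_nX+v_n)F_{n-1}(X)+F_{n-2}(X)$ for $n\ge1$; $\deg F_n=n$, so each polynomial $P$ of degree $r$ has a unique $\phi$-Zeckendorf representation $P=\sum_{i=0}^r z_iF_i(X)$, $z_i\in\boldsymbol{k}$. All matrices are indexed by $\mathbb N\times\mathbb N$ (rows and columns starting at 1). Let $\mathcal{B}_\phi=(b_{i,j})$ with $b_{i,i}=-v_i$, $b_{j+1,j}=1$, $b_{j-1,j}=-1$, and all other entries $0$; let $\mathcal{D}_\phi=\mathrm{diag}(u_1^{-1},u_2^{-1},\ldots)$ and $\mathcal{R}_\phi=\mathcal{B}_\phi\mathcal{D}_\phi$ (a tridiagonal matrix). The matrix $\mathcal{U}_\phi$ has columns $\mathbf{u}_1=(1,0,0,\ldots)^T$ and $\mathbf{u}_{n+1}=\mathcal{R}_\phi\mathbf{u}_n$ for $n\ge1$. The matrix $\mathcal{L}_\phi$ has rows $\mathbf{l}_1=(1,0,0,\ldots)$ and $\mathbf{l}_{n+1}=\mathbf{l}_n\mathcal{R}_\phi$ for $n\ge1$. The Hankel matrix associated with $\phi$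 is $\mathcal{M}_\phi=(m_{i,j})_{i,j\ge1}$ with $m_{i,j}=c_{i+j-1}$. (All matrix products here involve only finite sums.) *)

(* Defs.v *)
From HB Require Import structures.
From mathcomp Require Import all_boot all_algebra.
From mathcomp Require Import boolp classical_sets functions cardinality fsbigop.

Set Implicit Arguments.
Unset Strict Implicit.
Unset Printing Implicit Defensive.

Import GRing.Theory.
Local Open Scope ring_scope.

(* The ring k[[T]]. It is instantiated below at T = X^{-1}, so that
   fps_coef f i is the coefficient of X^{-i}. *)
Record fps (k : fieldType) := FPS { fps_coef : nat -> k }.

HB.instance Definition _ (k : fieldType) := gen_eqMixin (fps k).
HB.instance Definition _ (k : fieldType) := gen_choiceMixin (fps k).

Lemma fpsP (k : fieldType) (f g : fps k) :
  (forall i, fps_coef f i = fps_coef g i) -> f = g.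
Proof. by case: f g => [f] [g] /= /funext ->. Qed.

Definition fps_zero (k : fieldType) : fps k := FPS (fun=> 0).
Definition fps_opp (k : fieldType) (f : fps k) : fps k :=
  FPS (fun i => - fps_coef f i).
Definition fps_add (k : fieldType) (f g : fps k) : fps k :=
  FPS (fun i => fps_coef f i + fps_coef g i).
Definition fps_one (k : fieldType) : fps k := FPS (fun i => (i == 0%N)%:R).
Definition fps_mul (k : fieldType) (f g : fps k) : fps k :=
  FPS (fun n => \sum_(i < n.+1) fps_coef f i * fps_coef g (n - i)%N).

Lemma fps_addA (k : fieldType) : associative (@fps_add k).
Proof. by move=> f g h; apply: fpsP => i /=; rewrite addrA. Qed.
Lemma fps_addC (k : fieldType) : commutative (@fps_add k).
Proof. by move=> f g; apply: fpsP => i /=; rewrite addrC. Qed.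
Lemma fps_add0 (k : fieldType) : left_id (@fps_zero k) (@fps_add k).
Proof. by move=> f; apply: fpsP => i /=; rewrite add0r. Qed.
Lemma fps_addN (k : fieldType) :
  left_inverse (@fps_zero k) (@fps_opp k) (@fps_add k).
Proof. by move=> f; apply: fpsP => i /=; rewrite addNr. Qed.

HB.instance Definition _ (k : fieldType) :=
  GRing.isZmodule.Build (fps k) (@fps_addA k) (@fps_addC k) (@fps_add0 k)
    (@fps_addN k).

Definition fps_trunc (k : fieldType) (n : nat) (f : fps k) : {poly k} :=
  \poly_(i < n) fps_coef f i.

Lemma fps_mul_trunc (k : fieldType) (n i : nat) (f g : fps k) : (i < n)%N ->
  fps_coef (fps_mul f g) i = (fps_trunc n f * fps_trunc n g)`_i.
Proof.
move=> lt_in; rewrite coefM /=; apply: eq_bigr => j _; rewrite !coef_poly.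
have le_ji : (j <= i)%N by rewrite -ltnS.
by rewrite (leq_ltn_trans le_ji) // (leq_ltn_trans (leq_subr j i)).
Qed.

Lemma fps_mulC (k : fieldType) : commutative (@fps_mul k).
Proof.
move=> f g; apply: fpsP => i.
by rewrite !(@fps_mul_trunc _ i.+1) // mulrC.
Qed.

Lemma fps_mulA (k : fieldType) : associative (@fps_mul k).
Proof.
move=> f g h; apply: fpsP => i.
transitivity
  ((fps_trunc i.+1 f * (fps_trunc i.+1 g * fps_trunc i.+1 h))`_i).
  rewrite coefM; apply: eq_bigr => j _.
  rewrite (@fps_mul_trunc _ i.+1) ?ltnS ?leq_subr //.
  by rewrite [in RHS]/fps_trunc coef_poly ltn_ord.
rewrite mulrA coefM; apply: eq_bigr => j _.
rewrite (@fps_mul_trunc _ i.+1) //.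
by rewrite [fps_trunc _ h]/fps_trunc coef_poly ltnS leq_subr.
Qed.

Lemma fps_mul1 (k : fieldType) : left_id (@fps_one k) (@fps_mul k).
Proof.
move=> f; apply: fpsP => i; rewrite /= big_ord_recl /= mul1r subn0.
by rewrite big1 ?addr0 // => j _; rewrite mul0r.
Qed.

Lemma fps_mulDl (k : fieldType) : left_distributive (@fps_mul k) +%R.
Proof.
move=> f g h; apply: fpsP => i /=.
by rewrite -big_split; apply: eq_bigr => j _; rewrite mulrDl.
Qed.

Lemma fps_one_neq0 (k : fieldType) : @fps_one k != 0.
Proof.
by apply/eqP => /(congr1 (fun f => fps_coef f 0)) /= /eqP; rewrite oner_eq0.
Qed.

HB.instance Definition _ (k : fieldType) :=
  GRing.Zmodule_isComNzRing.Build (fps k) (@fps_mulA k) (@fps_mulC k)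
    (@fps_mul1 k) (@fps_mulDl k) (@fps_one_neq0 k).

Definition fps_unit (k : fieldType) : {pred fps k} :=
  fun f => `[< exists g : fps k, g * f = 1 >].
Definition fps_inv (k : fieldType) (f : fps k) : fps k :=
  if pselect (exists g : fps k, g * f = 1) is left ex_g
  then projT1 (cid ex_g) else f.

Lemma fps_mulV (k : fieldType) :
  {in @fps_unit k, left_inverse 1 (@fps_inv k) *%R}.
Proof.
move=> f /asboolP ex_g; rewrite /fps_inv.
by case: pselect => // ex_g'; case: cid.
Qed.
Lemma fps_unitP (k : fieldType) (f g : fps k) : g * f = 1 -> fps_unit f.
Proof. by move=> gf1; apply/asboolP; exists g. Qed.
Lemma fps_inv_out (k : fieldType) : {in [predC @fps_unit k], @fps_inv k =1 id}.
Proof.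
move=> f /negP nuf; rewrite /fps_inv.
by case: pselect => // ex_g; case: nuf; apply/asboolP.
Qed.

HB.instance Definition _ (k : fieldType) :=
  GRing.ComNzRing_hasMulInverse.Build (fps k) (@fps_mulV k) (@fps_unitP k)
    (@fps_inv_out k).

Lemma fps_order (k : fieldType) (f : fps k) : f != 0 ->
  exists2 n, fps_coef f n != 0 & forall i, (i < n)%N -> fps_coef f i = 0.
Proof.
move=> nz_f; have ex_n : exists n, fps_coef f n != 0.
  apply: contrapT => /forallNP f0; case/eqP: nz_f; apply: fpsP => i.
  by apply/eqP/negP => /negP/f0.
case: (ex_minnP ex_n) => n nz_fn min_n; exists n => // i lt_in.
by apply/eqP; apply: contraLR lt_in => /min_n; rewrite -leqNgt.
Qed.

Lemma fps_integral (k : fieldType) : GRing.integral_domain_axiom (fps k).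
Proof.
move=> f g fg0; apply/norP => -[/fps_order[m nz_fm f0] /fps_order[n nz_gn g0]].
have /eqP[] : fps_coef f m * fps_coef g n != 0 by rewrite mulf_neq0.
have := congr1 (fun h => fps_coef h (m + n)%N) fg0; rewrite /=.
have lt_m : (m < (m + n).+1)%N by rewrite ltnS leq_addr.
rewrite (bigD1 (Ordinal lt_m)) //= addKn big1 ?addr0 // => i ne_im.
case: (ltngtP i m) => [/f0 -> | lt_mi | eq_im]; first by rewrite mul0r.
  rewrite [X in _ * X]g0 ?mulr0 // ltn_subLR ?ltn_add2r //.
  by rewrite -ltnS ltn_ord.
by case/eqP: ne_im; apply: val_inj.
Qed.

HB.instance Definition _ (k : fieldType) :=
  GRing.ComUnitRing_isIntegral.Build (fps k) (@fps_integral k).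

(* k((X^{-1})), as the field of fractions of k[[X^{-1}]]. *)
Notation laurent k := {fraction (fps k)}.

Definition laurent_const (k : fieldType) (a : k) : laurent k :=
  tofrac (FPS (fun i => if i == 0%N then a else 0)).

Definition laurent_Xinv (k : fieldType) : laurent k :=
  tofrac (FPS (fun i => (i == 1%N)%:R)).

Definition laurent_poly (k : fieldType) (p : {poly k}) : laurent k :=
  \sum_(i < size p) laurent_const p`_i * (laurent_Xinv k)^-1 ^+ i.

(* \sum_(i >= 1) c_i X^{-i}; the value c 0 is ignored. *)
Definition laurent_expansion (k : fieldType) (c : nat -> k) : laurent k :=
  tofrac (FPS (fun i => if i == 0%N then 0 else c i)).

(* Convergence for the X^{-1}-adic topology, in which the
   X^{-N} k[[X^{-1}]] form a basis of neighbourhoods of 0. *)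
Definition laurent_cvg (k : fieldType) (s : nat -> laurent k) (x : laurent k)
    : Prop :=
  forall N : nat, exists n0 : nat, forall n, (n0 <= n)%N ->
    exists g : fps k, s n - x = laurent_Xinv k ^+ N * tofrac g.

(* [A_m; A_(m+1), ..., A_(m+n)] *)
Fixpoint fin_cfrac (k : fieldType) (A : nat -> {poly k}) (m n : nat)
    : laurent k :=
  if n is n'.+1 then laurent_poly (A m) + (fin_cfrac A m.+1 n')^-1
  else laurent_poly (A m).

(* x = [A_0; A_1, A_2, ...] *)
Definition is_cfrac (k : fieldType) (A : nat -> {poly k}) (x : laurent k)
    : Prop :=
  laurent_cvg (fin_cfrac A 0) x.

(* The sequences u, v and c are indexed from 1, as in the text: their value at
   0 is never used. *)
Definition pquot (k : fieldType) (u v : nat -> k) (i : nat) : {poly k} :=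
  if i == 0%N then 0 else u i *: 'X + (v i)%:P.

(* (F_n, F_(n-1)) *)
Fixpoint fib_pair (k : fieldType) (u v : nat -> k) (n : nat)
    : {poly k} * {poly k} :=
  if n is n'.+1 then
    let: (F1, F2) := fib_pair u v n' in
    ((u n *: 'X + (v n)%:P) * F1 + F2, F1)
  else (1, 0).

Definition fib (k : fieldType) (u v : nat -> k) (n : nat) : {poly k} :=
  (fib_pair u v n).1.

(* Matrices indexed by N x N; A i j stands for the entry in row i+1 and
   column j+1. *)
Definition imatrix (k : fieldType) := nat -> nat -> k.

(* Sums over all p : nat with finitely many nonzero terms (0 by convention if
   there are infinitely many, which does not happen for the products below). *)
Definition imx_mul (k : fieldType) (A B : imatrix k) : imatrix k :=
  fun i j => \sum_(p \in [set: nat]%classic) A i p * B p j.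
Definition imx_mulc (k : fieldType) (A : imatrix k) (x : nat -> k) : nat -> k :=
  fun i => \sum_(p \in [set: nat]%classic) A i p * x p.
Definition imx_mulr (k : fieldType) (x : nat -> k) (A : imatrix k) : nat -> k :=
  fun j => \sum_(p \in [set: nat]%classic) x p * A p j.

Definition Bmx (k : fieldType) (v : nat -> k) : imatrix k :=
  fun i j => if i == j then - v i.+1
             else if i == j.+1 then 1
             else if i.+1 == j then -1
             else 0.

Definition Dmx (k : fieldType) (u : nat -> k) : imatrix k :=
  fun i j => if i == j then (u i.+1)^-1 else 0.

Definition Rmx (k : fieldType) (u v : nat -> k) : imatrix k :=
  imx_mul (Bmx v) (Dmx u).

Definition ivec1 (k : fieldType) : nat -> k := fun i => (i == 0%N)%:R.

Definition Umx (k : fieldType) (u v : nat -> k) : imatrix k :=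
  fun i j => iter j (imx_mulc (Rmx u v)) (@ivec1 k) i.

Definition Lmx (k : fieldType) (u v : nat -> k) : imatrix k :=
  fun i j => iter i (fun x => imx_mulr x (Rmx u v)) (@ivec1 k) j.

(* m_(i,j) = c_(i+j-1) becomes c (i + j + 1) with indices shifted by 1. *)
Definition Mmx (k : fieldType) (c : nat -> k) : imatrix k :=
  fun i j => c (i + j).+1.

Definition lower_triangular (k : fieldType) (A : imatrix k) : Prop :=
  forall i j, (i < j)%N -> A i j = 0.
Definition upper_triangular (k : fieldType) (A : imatrix k) : Prop :=
  forall i j, (j < i)%N -> A i j = 0.
Definition is_hankel (k : fieldType) (A : imatrix k) : Prop :=
  forall i j i' j', (i + j = i' + j')%N -> A i j = A i' j'.

(* Main.v *)
Require Import Defs.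
From mathcomp Require Import all_boot all_algebra.
From mathcomp Require Import classical_sets fsbigop.
From mathcomp Require Import ring zify.
Set Implicit Arguments.
Unset Strict Implicit.
Unset Printing Implicit Defensive.
Import GRing.Theory.
Local Open Scope ring_scope.

(** In the basis of Fibonacci polynomials, multiplication by X has matrix R, so
    the columns R^n e_1 of U are the coordinates of X^n, and the (i, j) entry of
    L U is e_1^T R^(i+j) e_1, the F_0-coordinate of X^(i+j).  On the other hand
    c_(n+1) is the value at X^n of the linear functional sending a polynomial P
    to the coefficient of X^{-1} in P phi.  This functional is 1/u_1 at F_0 = 1
    and vanishes at F_n for n >= 1, because F_n is the denominator of a
    convergent of phi and so F_n phi - G_n has order n + 1 in X^{-1} for some
    polynomial G_n.  Hence c_(n+1) is 1/u_1 times the F_0-coordinate of X^n. *)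

(** * Power series *)

Section PowerSeries.
Variable k : fieldType.
Implicit Types f g : fps k.

Definition fpsX : fps k := FPS (fun i => (i == 1%N)%:R).
Definition fpsC (a : k) : fps k := FPS (fun i => if i == 0%N then a else 0).

Lemma fps_coefD f g i : fps_coef (f + g) i = fps_coef f i + fps_coef g i.
Proof. by []. Qed.

Lemma fps_coefN f i : fps_coef (- f) i = - fps_coef f i.
Proof. by []. Qed.

Lemma fps_coefM f g n :
  fps_coef (f * g) n = \sum_(i < n.+1) fps_coef f i * fps_coef g (n - i)%N.
Proof. by []. Qed.

Lemma fps_coef_sum (I : Type) (r : seq I) (F : I -> fps k) i :
  fps_coef (\sum_(j <- r) F j) i = \sum_(j <- r) fps_coef (F j) i.
Proof. by elim/big_rec2: _ => //= j y z _ <-. Qed.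

Lemma fps_coefCM a f i : fps_coef (fpsC a * f) i = a * fps_coef f i.
Proof.
rewrite fps_coefM big_ord_recl /= subn0 big1 ?addr0 // => j _.
by rewrite mul0r.
Qed.

Lemma fps_coefXM f i :
  fps_coef (fpsX * f) i = if i is i'.+1 then fps_coef f i' else 0.
Proof.
rewrite fps_coefM big_ord_recl /= mul0r add0r.
case: i => [|i]; first by rewrite big_ord0.
rewrite big_ord_recl /= mul1r subn1 big1 ?addr0 // => j _.
by rewrite mul0r.
Qed.

Lemma fps_coefXnM n f i : (i < n)%N -> fps_coef (fpsX ^+ n * f) i = 0.
Proof.
elim: n i => // n IHn [|i] lt_in; rewrite exprS -mulrA fps_coefXM //.
exact: IHn.
Qed.

Lemma fpsX_neq0 : fpsX != 0.
Proof.
apply/eqP => /(congr1 (fun f => fps_coef f 1)) /= /eqP.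
by rewrite oner_eq0.
Qed.

(** The inverse is the geometric series in [h]. As [h ^+ j] has no term below order j, the
    coefficient of index i is the same in all partial sums [s n] with n > i. *)
Lemma fps_unit_subX g : (1 - fpsX * g) \is a GRing.unit.
Proof.
pose h := fpsX * g; pose s n := \sum_(j < n) h ^+ j.
have s_stable m n i : (i < m <= n)%N -> fps_coef (s n) i = fps_coef (s m) i.
  case/andP=> lt_im /subnKC <-; rewrite /s big_split_ord fps_coefD.
  rewrite !fps_coef_sum [X in _ + X]big1 ?addr0 // => j _.
  by rewrite exprD /h exprMn -mulrA fps_coefXnM.
apply/unitrPr; exists (FPS (fun n => fps_coef (s n.+1) n)).
apply: fpsP => n.
transitivity (fps_coef ((1 - h) * s n.+1) n).
  rewrite !fps_coefM; apply: eq_bigr => i _; congr (_ * _).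
  by rewrite [RHS](s_stable (n - i).+1) //; lia.
rewrite -[1 - h]opprB mulNr -subrX1 opprB fps_coefD fps_coefN.
by rewrite exprMn fps_coefXnM // subr0.
Qed.

(** Dividing by the constant term leaves a series of the form 1 - X^{-1} g. *)
Lemma fps_unitE f : fps_coef f 0 != 0 -> f \is a GRing.unit.
Proof.
set a := fps_coef f 0 => nz_a.
have -> : f = fpsC a * (1 - fpsX * FPS (fun i => - a^-1 * fps_coef f i.+1)).
  apply: fpsP => i.
  rewrite fps_coefCM fps_coefD fps_coefN fps_coefXM /=.
  case: i => [|i] /=; first by rewrite subr0 mulr1.
  by rewrite sub0r mulNr opprK mulVKf.
rewrite unitrMl ?fps_unit_subX //; apply/unitrPr; exists (fpsC a^-1).
apply: fpsP => -[|i]; rewrite fps_coefCM /= ?mulr0 //.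
exact: divff.
Qed.

End PowerSeries.

Arguments fpsX {k}.

(** * Infinite matrices and the basis of Fibonacci polynomials *)

Section Tridiagonal.
Variables (k : fieldType) (u v : nat -> k).
Hypothesis u_neq0 : forall i, (1 <= i)%N -> u i != 0.

Let R := Rmx u v.
Let U := Umx u v.
Let L := Lmx u v.
Let F := fib u v.

(** The bound [n] is free beyond the support, so that several sums can be given a common range
    before they are exchanged. *)
Lemma fsbigT_ord n (f : nat -> k) : (forall p, (n <= p)%N -> f p = 0) ->
  \sum_(p \in [set: nat]%classic) f p = \sum_(p < n) f p.
Proof.
move=> f0; rewrite (fsbig_ord +%R n f);
  apply/esym/fsbig_widen => // p [_ /negP].
by rewrite -leqNgt => /f0.
Qed.

Lemma RmxE i j : R i j = Bmx v i j * (u j.+1)^-1.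
Proof.
rewrite /R /Rmx /imx_mul (@fsbigT_ord j.+1) => [|p lt_jp].
  rewrite big_ord_recr /= big1 ?add0r => [|p _]; rewrite /Dmx ?eqxx //.
  by rewrite ltn_eqF ?mulr0.
by rewrite /Dmx gtn_eqF ?mulr0.
Qed.

Lemma Rmx_diag i : R i i = - v i.+1 / u i.+1.
Proof. by rewrite RmxE /Bmx eqxx. Qed.

Lemma Rmx_sub i : R i.+1 i = (u i.+1)^-1.
Proof. by rewrite RmxE /Bmx ifF ?eqxx ?mul1r //; lia. Qed.

Lemma Rmx_super i : R i i.+1 = - (u i.+2)^-1.
Proof. by rewrite RmxE /Bmx 2?ifF ?eqxx ?mulN1r //; lia. Qed.

Lemma Rmx_lower i j : (i.+1 < j)%N -> R i j = 0.
Proof. by move=> lt_ij; rewrite RmxE /Bmx !ifF ?mul0r //; lia. Qed.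

Lemma Rmx_upper i j : (j.+1 < i)%N -> R i j = 0.
Proof. by move=> lt_ij; rewrite RmxE /Bmx !ifF ?mul0r //; lia. Qed.

Lemma Umx_step i j : U i j.+1 = \sum_(p \in [set: nat]%classic) R i p * U p j.
Proof. by []. Qed.

Lemma Lmx_step i j : L i.+1 j = \sum_(p \in [set: nat]%classic) L i p * R p j.
Proof. by []. Qed.

Lemma Umx_upper : upper_triangular U.
Proof.
move=> i j; elim: j i => [|j IHj] i lt_ji;
  first by rewrite /U /Umx /= /ivec1 gtn_eqF.
rewrite Umx_step; apply: fsbig1 => p _.
case: (ltnP j p) => [/IHj -> | le_pj]; first by rewrite mulr0.
by rewrite Rmx_upper ?mul0r //; lia.
Qed.

Lemma Lmx_lower : lower_triangular L.
Proof.
elim=> [|i IHi] j lt_ij; first by rewrite /L /Lmx /= /ivec1 gtn_eqF.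
rewrite Lmx_step; apply: fsbig1 => p _.
case: (ltnP i p) => [/IHi -> | le_pi]; first by rewrite mul0r.
by rewrite Rmx_lower ?mulr0 //; lia.
Qed.

Lemma UmxS n i j : (j < n)%N -> U i j.+1 = \sum_(p < n) R i p * U p j.
Proof.
move=> lt_jn; rewrite Umx_step (@fsbigT_ord n) // => p le_np.
by rewrite [X in _ * X]Umx_upper ?mulr0 //; lia.
Qed.

Lemma LmxS n i j : (i < n)%N -> L i.+1 j = \sum_(p < n) L i p * R p j.
Proof.
move=> lt_in; rewrite Lmx_step (@fsbigT_ord n) // => p le_np.
by rewrite [X in X * _]Lmx_lower ?mul0r //; lia.
Qed.

(** Only the subdiagonal of R meets the last nonzero entry of the previous column, so each diagonal
    entry is the preceding one times 1/u_(i+1). *)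
Lemma Umx_diag_neq0 i : U i i != 0.
Proof.
elim: i => [|i IHi]; first by rewrite /U /Umx /= /ivec1 oner_neq0.
rewrite (@UmxS i.+1) // big_ord_recr /= big1 ?add0r => [|p _].
  by rewrite mulf_neq0 // Rmx_sub invr_neq0 ?u_neq0.
by rewrite Rmx_upper ?mul0r // !ltnS.
Qed.

Lemma Lmx_diag_neq0 i : L i i != 0.
Proof.
elim: i => [|i IHi]; first by rewrite /L /Lmx /= /ivec1 oner_neq0.
rewrite (@LmxS i.+1) // big_ord_recr /= big1 ?add0r => [|p _].
  by rewrite mulf_neq0 // Rmx_super oppr_eq0 invr_neq0 ?u_neq0.
by rewrite Rmx_lower ?mulr0 // !ltnS.
Qed.

Lemma LUmxE n i j : (i < n)%N -> imx_mul L U i j = \sum_(p < n) L i p * U p j.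
Proof.
move=> lt_in; rewrite /imx_mul (@fsbigT_ord n) // => p le_np.
by rewrite Lmx_lower ?mul0r //; lia.
Qed.

(* The rows of L are e_1 R^i and the columns of U are R^j e_1. *)
Lemma LUmx_shift i j : imx_mul L U i.+1 j = imx_mul L U i j.+1.
Proof.
pose n := (i + j).+2.
have [lt_in lt_jn lt_Sin] : [/\ i < n, j < n & i.+1 < n]%N by rewrite /n;
  split; lia.
rewrite !(@LUmxE n) //.
under eq_bigr do rewrite (LmxS _ lt_in) mulr_suml.
rewrite exchange_big; apply: eq_bigr => p _.
by rewrite (UmxS _ lt_jn) mulr_sumr; apply: eq_bigr => q _; rewrite mulrA.
Qed.

(** Repeated shifts move the whole row index into the column index, and the first row of L is
    e_1. *)
Lemma LUmx_first_row i j : imx_mul L U i j = U 0%N (i + j)%N.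
Proof.
elim: i j => [|i IHi] j; last by rewrite LUmx_shift IHi addnS.
by rewrite (@LUmxE 1) // big_ord1 /L /Lmx /= /ivec1 mul1r.
Qed.

(** * Fibonacci polynomials as a basis of k[X] *)

Lemma fib_pairE n :
  fib_pair u v n.+1 = ((u n.+1 *: 'X + (v n.+1)%:P) * F n + (fib_pair u v n).2,
    F n).
Proof. by rewrite /F /fib /=; case: fib_pair. Qed.

Lemma fib0 : F 0 = 1.
Proof. by []. Qed.

Lemma fib1 : F 1 = (u 1 *: 'X + (v 1)%:P) * F 0 + 0.
Proof. by rewrite {1}/F /fib fib_pairE. Qed.

Lemma fibSS n : F n.+2 = (u n.+2 *: 'X + (v n.+2)%:P) * F n.+1 + F n.
Proof. by rewrite {1}/F /fib fib_pairE fib_pairE. Qed.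

Lemma size_pquot n : (0 < n)%N -> size (u n *: 'X + (v n)%:P) = 2%N.
Proof.
move=> n_gt0; rewrite size_polyDl size_scale ?u_neq0 ?size_polyX //.
by rewrite ltnS size_polyC leq_b1.
Qed.

Lemma size_fib n : size (F n) = n.+1.
Proof.
suff [] : size (F n) = n.+1 /\ size (F n.+1) = n.+2 by [].
elim: n => [|n [IHn IHSn]].
  by rewrite fib1 fib0 mulr1 addr0 size_poly1 size_pquot.
split=> //; rewrite fibSS.
have size_mul_fib : size ((u n.+2 *: 'X + (v n.+2)%:P) * F n.+1) = n.+3.
  by rewrite size_mul -?size_poly_eq0 ?size_pquot ?IHSn.
by rewrite size_polyDl size_mul_fib // IHn; lia.
Qed.

Lemma fib_free n (a : nat -> k) : \sum_(i < n) a i *: F i = 0 ->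
  forall i, (i < n)%N -> a i = 0.
Proof.
elim: n => // n IHn; rewrite big_ord_recr /= => sum0.
have a_n0 : a n = 0.
  have := congr1 (fun p : {poly k} => p`_n) sum0.
  rewrite coefD coef_sum big1 ?add0r => [|i _]; last first.
    by rewrite coefZ nth_default ?mulr0 // size_fib.
  rewrite coefZ coef0 => /eqP; rewrite mulf_eq0 => /orP[/eqP // | ].
  rewrite -[X in _`_X]/n.+1.-1 -size_fib -lead_coefE lead_coef_eq0.
  by rewrite -size_poly_eq0 size_fib.
move: sum0; rewrite a_n0 scale0r addr0 => /IHn a0 i.
by rewrite ltnS leq_eqVlt => /predU1P[-> | /a0].
Qed.

(** Column j of R is the recurrence solved for X F_j: u_(j+1) X F_j = F_(j+1) - v_(j+1) F_j -
    F_(j-1), where the last term is absent for j = 0. *)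
Lemma mulX_fib n j : (j.+1 < n)%N -> 'X * F j = \sum_(p < n) R p j *: F p.
Proof.
move=> /subnKC <-; rewrite big_split_ord /= [X in _ + X]big1 ?addr0 => [|p _];
  last first.
  by rewrite Rmx_upper ?scale0r //; lia.
have nz_u : u j.+1 != 0 by rewrite u_neq0.
apply: (scalerI nz_u); rewrite 2!big_ord_recr /= Rmx_diag Rmx_sub.
rewrite !scalerDr !scalerA mulfV // scale1r mulrCA divff // mulr1.
case: j nz_u => [|j] nz_u.
  rewrite big_ord0 fib1 !fib0 scaler0 add0r !mulr1 addr0 scaleNr alg_polyC.
  by rewrite addrC addrK.
rewrite big_ord_recr /= big1 ?add0r => [|p _]; last first.
  by rewrite Rmx_lower ?scale0r // !ltnS.
rewrite fibSS Rmx_super scalerA mulrN divff // !scaleNr scale1r mulrDl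
  -mul_polyC.
rewrite -!mul_polyC; ring.
Qed.

Lemma Umx_zeckendorf n : 'X^n = \sum_(i < n.+1) U i n *: F i.
Proof.
elim: n => [|n IHn]; first by rewrite big_ord1 fib0 /U /Umx /= /ivec1 scale1r.
rewrite exprS {}IHn mulr_sumr.
have mulX_term (i : 'I_n.+1) :
    'X * (U i n *: F i) = \sum_(p < n.+2) (U i n * R p i) *: F p.
  rewrite -scalerAr (@mulX_fib n.+2 i (ltn_ord i)) scaler_sumr.
  by apply: eq_bigr => p _; rewrite scalerA.
rewrite (eq_bigr _ (fun i _ => mulX_term i)) exchange_big;
  apply: eq_bigr => p _.
by rewrite (@UmxS n.+1) // scaler_suml; apply: eq_bigr => i _; rewrite mulrC.
Qed.

Lemma Umx_zeckendorf_unique n (z : nat -> k) :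
  'X^n = \sum_(i < n.+1) z i *: F i ->
  forall i, U i n = if (i <= n)%N then z i else 0.
Proof.
move=> Xn_z i; case: leqP => [le_in | /Umx_upper //].
have /(@fib_free _ (fun i => U i n - z i)) a0 : \sum_(i < n.+1) (U i n - z i)
  *: F i = 0.
  under eq_bigr do rewrite scalerBl.
  by rewrite big_split /= sumrN -Xn_z -Umx_zeckendorf subrr.
by apply/eqP; rewrite -subr_eq0; apply/eqP/a0; rewrite ltnS.
Qed.

End Tridiagonal.

(** * The linear functional attached to a power series *)

Section Pairing.
Variable k : fieldType.
Implicit Types (s : nat -> k) (p q : {poly k}).

(* When [s i] is the coefficient of X^{-(i+1)} in a Laurent series, this is the
   coefficient of X^{-1} in its product with [p]. *)
Definition pairing s p : k := \sum_(i < size p) p`_i * s i.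

Lemma pairing_widen n s p : (size p <= n)%N ->
  pairing s p = \sum_(i < n) p`_i * s i.
Proof.
move=> /subnKC <-; rewrite big_split_ord /= [X in _ + X]big1 ?addr0 // => i _.
by rewrite nth_default ?mul0r // leq_addr.
Qed.

Lemma eq_pairing s t p : (forall i, (i < size p)%N -> s i = t i) ->
  pairing s p = pairing t p.
Proof. by move=> eq_st; apply: eq_bigr => i _; rewrite eq_st. Qed.

Lemma pairingD s p q : pairing s (p + q) = pairing s p + pairing s q.
Proof.
pose n := maxn (size p) (size q).
rewrite !(@pairing_widen n) ?size_polyD ?leq_maxl ?leq_maxr //.
by rewrite -big_split; apply: eq_bigr => i _; rewrite coefD mulrDl.
Qed.

Lemma pairingZ s a p : pairing s (a *: p) = a * pairing s p.
Proof.
rewrite !(@pairing_widen (size p)) ?size_scale_leq // mulr_sumr.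
by apply: eq_bigr => i _; rewrite coefZ mulrA.
Qed.

Lemma pairing0 s : pairing s 0 = 0.
Proof. by rewrite /pairing size_poly0 big_ord0. Qed.

Lemma pairing_sum s n (P : nat -> {poly k}) :
  pairing s (\sum_(i < n) P i) = \sum_(i < n) pairing s (P i).
Proof.
by elim: n => [|n IHn]; rewrite ?big_ord0 ?pairing0 // !big_ord_recr pairingD
  IHn.
Qed.

(** The factor X passes from the polynomial to the series, where it shifts the coefficients. *)
Lemma pairingMX s p : pairing s ('X * p) = pairing (s \o succn) p.
Proof.
rewrite (@pairing_widen (size p).+1); last first.
  by rewrite (leq_trans (size_polyMleq _ _)) // size_polyX.
rewrite big_ord_recl coefXM mul0r add0r.
by apply: eq_bigr => i _; rewrite coefXM.
Qed.

Lemma pairingXn s n : pairing s 'X^n = s n.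
Proof.
rewrite /pairing size_polyXn big_ord_recr /= coefXn eqxx mul1r big1 ?add0r //
  => i _.
by rewrite coefXn ltn_eqF ?mul0r.
Qed.

Lemma pairing_recurrence s a b p q :
  pairing s ((a *: 'X + b%:P) * p + q) =
    a * pairing (s \o succn) p + b * pairing s p + pairing s q.
Proof.
by rewrite pairingD mulrDl pairingD -scalerAl mul_polyC !pairingZ pairingMX.
Qed.

End Pairing.

(** * Continued fractions *)

Section ContinuedFraction.
Variables (k : fieldType) (u v : nat -> k).
Hypothesis u_neq0 : forall i, (1 <= i)%N -> u i != 0.

(* The inverse of [A_m; A_(m+1), ..., A_(m+n)], which is a power series in
   X^{-1}. *)
Fixpoint cf_tail (m n : nat) : fps k :=
  fpsX / (fpsC (u m)
          + fpsX * (fpsC (v m) + if n is n'.+1 then cf_tail m.+1 n' else 0)).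

Lemma cf_tailM m n : (0 < m)%N ->
  cf_tail m n * (fpsC (u m)
     + fpsX * (fpsC (v m) + if n is n'.+1 then cf_tail m.+1 n' else 0)) = fpsX.
Proof.
move=> m_gt0; set d := _ + _; have -> : cf_tail m n = fpsX / d by case: n @d.
rewrite divrK // fps_unitE // /d fps_coefD fps_coefXM addr0.
exact: u_neq0.
Qed.

Lemma cf_tail_dvdX m n : exists g, cf_tail m n = fpsX * g.
Proof. by case: n => [|n]; eexists. Qed.

(** With T = X^{-1}, this is u X + v = (u + T v) / T. *)
Lemma laurent_poly_pquot m : (0 < m)%N ->
  laurent_poly (pquot u v m) =
    tofrac (fpsC (u m) + fpsX * fpsC (v m)) / tofrac fpsX.
Proof.
move=> m_gt0; rewrite /pquot gtn_eqF // /laurent_poly size_pquot //.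
rewrite big_ord_recl big_ord1 !coefD !coefZ !coefX !coefC /= !mulr0 mulr1
  !(add0r, addr0).
rewrite mulr1 expr1 /laurent_const /laurent_Xinv -/(fpsC _) -/(fpsC _) -/fpsX.
have nzX : tofrac (@fpsX k) != 0 by rewrite tofrac_eq0 fpsX_neq0.
rewrite tofracD tofracM mulrDl [_ * tofrac (fpsC (v m))]mulrC mulfK //.
exact: addrC.
Qed.

(** [cf_tailM] is the recursion of [fin_cfrac] with denominators cleared. Tails are nonzero because
    they divide X^{-1}. *)
Lemma fin_cfrac_tail m n : (0 < m)%N ->
  fin_cfrac (pquot u v) m n = (tofrac (cf_tail m n))^-1.
Proof.
elim: n m => [|n IHn] m m_gt0; have nzX : tofrac (@fpsX k) != 0.
- by rewrite tofrac_eq0 fpsX_neq0.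
- rewrite [LHS]laurent_poly_pquot //.
  have := congr1 (@tofrac _) (cf_tailM 0 m_gt0);
    rewrite addr0 tofracM => tail_eq.
  have [nz_t nz_d] : tofrac (cf_tail m 0) != 0 /\ tofrac (fpsC (u m) + fpsX *
    fpsC (v m)) != 0.
    by apply/andP; rewrite -negb_or -mulf_eq0 tail_eq.
  by rewrite -tail_eq invfM mulrCA mulfV ?mulr1.
- by rewrite tofrac_eq0 fpsX_neq0.
rewrite /fin_cfrac -/fin_cfrac IHn // invrK laurent_poly_pquot //.
have := congr1 (@tofrac _) (cf_tailM n.+1 m_gt0).
rewrite [fpsX * (_ + _)]mulrDr addrA tofracM tofracD [tofrac (fpsX * cf_tail _
  _)]tofracM => tail_eq.
have nz_t : tofrac (cf_tail m n.+1) != 0.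
  by apply: contra_eq_neq tail_eq => ->; rewrite mul0r eq_sym.
apply: (mulfI nz_t); rewrite mulfV // mulrDr mulrA; apply: (mulIf nzX).
by rewrite mul1r -[RHS]tail_eq mulrDl mulfVK // mulrDr; congr (_ + _); ring.
Qed.

(* With r_i the tail starting at A_(i+1) and G_n / F_n the convergents of r_0,
   the remainder e_n = F_n r_0 - G_n satisfies e_n = - r_n e_(n-1). *)
Definition cf_remainder (N n : nat) : fps k :=
  (-1) ^+ n * \prod_(i < n.+1) cf_tail i.+1 (N - i).

Lemma cf_remainder0 N : cf_remainder N 0 = cf_tail 1 N.
Proof. by rewrite /cf_remainder big_ord1 expr0 mul1r subn0. Qed.

Lemma cf_remainderS N n :
  cf_remainder N n.+1 = - (cf_remainder N n * cf_tail n.+2 (N - n.+1)).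
Proof. by rewrite /cf_remainder big_ord_recr /= exprS mulN1r !mulNr mulrA. Qed.

Lemma cf_remainder_dvdX N n : exists g, cf_remainder N n = fpsX ^+ n.+1 * g.
Proof.
elim: n => [|n [g IHn]].
  by rewrite cf_remainder0 expr1; apply: cf_tail_dvdX.
have [h tail_h] := cf_tail_dvdX n.+2 (N - n.+1).
by exists (- (g * h)); rewrite cf_remainderS IHn tail_h [in RHS]exprSr; ring.
Qed.

Lemma cf_tail_remainder N n : (n < N)%N ->
  cf_tail n.+1 (N - n) * (fpsC (u n.+1) + fpsX * (fpsC (v n.+1)
    + cf_tail n.+2 (N - n.+1))) = fpsX.
Proof. by move=> lt_nN; rewrite -(subnSK lt_nN); apply: cf_tailM. Qed.

(** This is the recurrence of the F_n multiplied by X^{-1}, with e_(-1) = -1. *)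
Lemma cf_remainder_rec1 N : (0 < N)%N ->
  fpsX * cf_remainder N 1 =
    (fpsC (u 1) + fpsX * fpsC (v 1)) * cf_remainder N 0 - fpsX.
Proof.
move=> N_gt0; rewrite -[X in _ - X](cf_tail_remainder N_gt0) cf_remainderS
  cf_remainder0.
by rewrite subn0; ring.
Qed.

(** The remainders obey the recurrence of the F_n, here multiplied by X^{-1}: in X^{-1} e_n, replace
    X^{-1} by r_(n+1) (u_(n+2) + X^{-1} (v_(n+2) + r_(n+2))) and use e_(i+1) = - r_(i+1) e_i. *)
Lemma cf_remainder_rec N n : (n.+1 < N)%N ->
  fpsX * cf_remainder N n.+2 =
    (fpsC (u n.+2) + fpsX * fpsC (v n.+2)) * cf_remainder N n.+1
    + fpsX * cf_remainder N n.
Proof.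
move=> lt_nN; rewrite -[X in _ + X * _](cf_tail_remainder lt_nN)
  !cf_remainderS; ring.
Qed.

(** The left side is the coefficient of X^{-(j+1)} in F_n r_0, to which the polynomial G_n
    contributes nothing. Both sides obey the same recurrence in n; multiplication by X raises j, so
    the induction is over all j at once. *)
Lemma pairing_fib N n j : (n <= N)%N ->
  pairing (fun i => fps_coef (cf_tail 1 N) (i + j).+1) (fib u v n) =
  fps_coef (cf_remainder N n) j.+1.
Proof.
pose s j i := fps_coef (cf_tail 1 N) (i + j).+1.
pose A n := (n <= N)%N -> forall j, pairing (s j) (fib u v n) =
  fps_coef (cf_remainder N n) j.+1.
have shift_s i p : pairing (s i \o succn) p = pairing (s i.+1) p.
  by apply: eq_pairing => l _; rewrite /s /= addnS.
suff [An _] : A n /\ A n.+1 by move=> le_nN; apply: An.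
elim: n {j} => [|n [IHn IHSn]].
  have A0 : A 0%N.
    move=> _ j; rewrite fib0 -(expr0 'X) pairingXn cf_remainder0.
    by rewrite /s add0n.
  split=> // lt_0N j; rewrite fib1 pairing_recurrence pairing0 addr0 shift_s.
  rewrite !A0 //.
  (* The recurrence carries a factor X^{-1}, hence index j + 2 rather than j + 1; the term - X^{-1}
     has no coefficient there. *)
  have := congr1 (fun f => fps_coef f j.+2) (cf_remainder_rec1 lt_0N).
  rewrite mulrDl -mulrA !(fps_coefXM, fps_coefD, fps_coefCM, fps_coefN).
  by move=> ->; rewrite subr0.
split=> // lt_nN j; rewrite fibSS pairing_recurrence shift_s.
rewrite !IHSn ?IHn; try lia.
have := congr1 (fun f => fps_coef f j.+2) (cf_remainder_rec lt_nN).
by rewrite mulrDl -mulrA !(fps_coefXM, fps_coefD, fps_coefCM).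
Qed.

(** In [cf_tailM] at order 1, the tail meets only the constant term [u 1] of the denominator, since
    the tail itself has order at least 1. *)
Lemma cf_tail_coef1 n : fps_coef (cf_tail 1 n) 1 = (u 1)^-1.
Proof.
have [g tail_g] := cf_tail_dvdX 1 n.
have := congr1 (fun f => fps_coef f 1) (cf_tailM n (ltn0Sn 0)).
rewrite mulrC mulrDl -mulrA {2}tail_g.
rewrite fps_coefD fps_coefCM fps_coefXM mulrCA fps_coefXM addr0 /= => uc1.
by rewrite -[LHS](mulKf (u_neq0 (leqnn 1))) uc1 mulr1.
Qed.

Lemma cfrac_approx (c : nat -> k) :
  is_cfrac (pquot u v) (laurent_expansion c) ->
  forall n, exists2 N, (n <= N)%N &
    forall i, (i < n)%N -> fps_coef (cf_tail 1 N) i.+1 = c i.+1.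
Proof.
move=> c_cfrac n; have [n0 close] := c_cfrac n.+1.
(* Since A_0 = 0, [A_0; A_1, ..., A_(N+1)] is [cf_tail 1 N], hence the successor. *)
have [|g] := close (maxn n0 n).+1; first by rewrite leqW ?leq_maxl.
rewrite /fin_cfrac -/fin_cfrac fin_cfrac_tail // invrK /laurent_poly size_poly0
  big_ord0.
rewrite add0r /laurent_expansion /laurent_Xinv -/fpsX -tofracXn -tofracM
  -tofracB.
move=> /eqP; rewrite tofrac_eq => /eqP tail_c.
exists (maxn n0 n); first exact: leq_maxr.
move=> i lt_in; have := congr1 (fun f => fps_coef f i.+1) tail_c.
by rewrite fps_coefXnM // fps_coefD fps_coefN => /eqP; rewrite subr_eq0 => /eqP.
Qed.

(** As F_n has degree n, only c_1, ..., c_(n+1) matter, so phi may be replaced by a finite continued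
    fraction that agrees with it to that order. *)
Lemma pairing_fib_expansion (c : nat -> k) n :
  is_cfrac (pquot u v) (laurent_expansion c) ->
  pairing (c \o succn) (fib u v n) = (n == 0%N)%:R / u 1.
Proof.
move=> c_cfrac; have [N lt_nN c_tail] := cfrac_approx c_cfrac n.+1.
transitivity (fps_coef (cf_remainder N n) 1).
  rewrite -pairing_fib 1?ltnW //; apply: eq_pairing => i.
  by rewrite size_fib // addn0 => /c_tail.
case: n {c_tail lt_nN} => [|n]; first by rewrite cf_remainder0 cf_tail_coef1
  mul1r.
by have [g ->] := cf_remainder_dvdX N n.+1; rewrite fps_coefXnM // mul0r.
Qed.

Lemma expansion_Umx (c : nat -> k) n :
  is_cfrac (pquot u v) (laurent_expansion c) -> c n.+1 = (u 1)^-1 * Umx u v 0 n.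
Proof.
move=> c_cfrac.
rewrite -[LHS](pairingXn (c \o succn)) (Umx_zeckendorf v u_neq0).
rewrite (pairing_sum _ _ (fun i => Umx u v i n *: fib u v i)).
under eq_bigr do rewrite pairingZ pairing_fib_expansion //.
rewrite big_ord_recl /= big1 ?addr0 => [|i _]; last by rewrite mul0r mulr0.
by rewrite mul1r mulrC.
Qed.

End ContinuedFraction.

Theorem theorem1 (k : fieldType) (u v c : nat -> k) (phi : laurent k)
  (u_neq0 : forall i, (1 <= i)%N -> u i != 0)
  (phi_cfrac : is_cfrac (pquot u v) phi)
  (phi_expansion : phi = laurent_expansion c) :
  [/\ (lower_triangular (Lmx u v) /\ upper_triangular (Umx u v)) /\
      ((forall i, Lmx u v i i != 0) /\ (forall i, Umx u v i i != 0)),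
      forall n,
        (exists z : nat -> k, 'X^n = \sum_(i < n.+1) z i *: fib u v i) /\
        (forall z : nat -> k, 'X^n = \sum_(i < n.+1) z i *: fib u v i ->
           forall i, Umx u v i n = if (i <= n)%N then z i else 0),
      is_hankel (imx_mul (Lmx u v) (Umx u v)) &
      forall i j,
        (u 1%N)^-1 * imx_mul (Lmx u v) (Umx u v) i j = Mmx c i j].
Proof.
subst phi; split.
- split; first by split; [apply: Lmx_lower | apply: Umx_upper].
  by split=> i; [apply: Lmx_diag_neq0 | apply: Umx_diag_neq0].
- move=> n; split; last exact: Umx_zeckendorf_unique.
  by exists (fun i => Umx u v i n); apply: Umx_zeckendorf.
- by move=> i j i' j' eq_ij; rewrite !LUmx_first_row eq_ij.
by move=> i j; rewrite LUmx_first_row /Mmx (expansion_Umx u_neq0 _ phi_cfrac).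
Qed.
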